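(* The pair $(\{\mathrm{Cay}_k(x;y)\}_{k=0}^\infty,\{k!\}_{k=0}^\infty)$ is a palindromic pair with degree $n$. Namely, let $n\in\mathbb{Z}_{\ge0}$ and $s\in\mathscr{S}_{n+1}(\mathrm{Cay};n)=\{s\in\mathbb{C}:\mathrm{Cay}_{n+1}(s;n)=0\}$. Then $\mathrm{Cay}_k(s;n)=0$ for $k\ge n+1$, and $$\frac{\mathrm{Cay}_k(s;n)}{k!}=(-1)^{\frac{n-s}{2}}\frac{\mathrm{Cay}_{n-k}(s;n)}{(n-k)!}\qquad\text{for } k\le n.$$ In particular, $\mathrm{Cay}_n(s;n)=(-1)^{\frac{n-s}{2}}n!$ for $s\in\mathscr{S}_{n+1}(\mathrm{Cay};n)$.
   Context: Palindromic pairs. Let $\{p_k(x;y)\}_{k=0}^\infty$ be a sequence of polynomials in two variables with $p_0(x;y)=1$, $\{a_k\}_{k=0}^\infty$ a sequence of non-zero numbers, and $d\colon\mathbb{Z}_{\ge0}\to\mathbb{R}$ a map. For $n\in\mathbb{Z}_{\ge0}$ put $\mathscr{S}_k(p;n)=\{s\in\mathbb{C}:p_k(s;n)=0\}$. The pair $(\{p_k\},\{a_k\})$ is a palindromic pair with degree $d(n)$ if, for each $n\in\mathbb{Z}_{\ge 0}$ with $d(n)\in\mathbb{Z}_{\ge0}$, there exists a map $\theta_{(p;n)}\colon\mathscr{S}_{d(n)+1}(p;n)\to\{\pm1\}$ such that for all $s\in\mathscr{S}_{d(n)+1}(p;n)$ we have $p_k(s;n)=0$ for $k\ge d(n)+1$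 and $\frac{p_k(s;n)}{a_k}=\theta_{(p;n)}(s)\frac{p_{d(n)-k}(s;n)}{a_{d(n)-k}}$ for $0\le k\le d(n)$. Cayley continuants. $\mathrm{Cay}_0(x;y)=1$, and for $k\ge1$, $\mathrm{Cay}_k(x;y)$ is the determinant of the $k\times k$ tridiagonal matrix with all diagonal entries equal to $x$, entry $i$ in position $(i,i+1)$, and entry $y-i+1$ in position $(i+1,i)$ $(1\le i\le k-1)$. By Sylvester's formula, $\mathscr{S}_{n+1}(\mathrm{Cay};n)=\{n-2\ell:\ell=0,1,\ldots,n\}$, so $\frac{n-s}{2}$ is an integer. *)

(* Defs.v *)
From mathcomp Require Import all_boot all_order all_algebra.
From mathcomp Require Import classical_sets reals.
From mathcomp Require Export complex.

Set Implicit Arguments.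
Unset Strict Implicit.
Unset Printing Implicit Defensive.

Import GRing.Theory.
Local Open Scope ring_scope.

(* A polynomial p(x; y) is an element of {poly {poly R[i]}} with outer
   variable x = 'X and inner variable y = 'Y; its value at (s, n) is
   p.[s, n]. *)

Definition zeroset (R : realType) (p : nat -> {poly {poly R[i]}}) (k n : nat)
    : set R[i] :=
  [set s : R[i] | (p k).[s, n%:R] = 0]%classic.

(* The condition d(n) \in Z_{>=0} is expressed by naming the (unique) natural
   number m with d(n) = m. The sign map theta is total, but only its values on
   the zero set are constrained. *)
Definition palindromic_pair (R : realType) (p : nat -> {poly {poly R[i]}})
    (a : nat -> R[i]) (d : nat -> R) : Prop :=
  [/\ p 0%N = 1,
      forall k : nat, a k != 0 &
      forall n m : nat, d n = m%:R ->
        exists theta : R[i] -> R[i],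
          forall s : R[i], zeroset p m.+1 n s ->
            [/\ theta s = 1 \/ theta s = -1,
                forall k : nat, (m.+1 <= k)%N -> (p k).[s, n%:R] = 0 &
                forall k : nat, (k <= m)%N ->
                  (p k).[s, n%:R] / a k =
                  theta s * ((p (m - k)%N).[s, n%:R] / a (m - k)%N)]].

(* With indices starting at 0, the entry at (i, i+1) is i + 1 and the entry at
   (i+1, i) is y - i. For k = 0 the determinant of the empty matrix is 1. *)
Definition Cay (R : realType) (k : nat) : {poly {poly R[i]}} :=
  \det (\matrix_(i < k, j < k)
     (if j == i :> nat then 'X
      else if j == i.+1 :> nat then (i.+1)%:R
      else if i == j.+1 :> nat then 'Y - j%:R
      else 0)).

(* Main.v *)
Require Import Defs.
From mathcomp Require Import all_boot all_order all_algebra.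
From mathcomp Require Import classical_sets reals complex.
From mathcomp Require Import zify ring.

Local Open Scope ring_scope.
Import GRing.Theory Num.Theory.

(** Fix n and s and put c_k = Cay_k(s; n) / k!.  Expanding the tridiagonal
determinant along its last row gives the three-term recurrence
  (k + 2) c_(k+2) = s c_(k+1) - (n - k) c_k,   c_0 = 1,   c_1 = s.
Suppose now that c_(n+1) = 0.

The coefficient n - k vanishes at k = n, so the recurrence also gives
c_(n+2) = 0, and then every later c_k is zero ([normCay_vanish]).

The substitution k -> n - k preserves the recurrence on 0 <= k <= n: solved
for its lowest term at index n - k - 2, it is the same recurrence for the
reversed sequence c_(n-k).  Because c_(n+1) = 0, the reversed sequence starts
with c_n, s c_n, hence c_(n-k) = c_n c_k ([normCay_reflect]).

It remains to identify c_n.  For s = n - 2 l with 0 <= l <= n, the polynomial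
(1 + X)^(n - l) (1 - X)^l solves a first-order differential equation which,
read on coefficients, is the recurrence of the c_k; so this polynomial is the
generating function of the c_k ([normCay_genPoly]).  It has degree n, hence
c_(n+1) = 0, and its leading coefficient is c_n = (-1)^l.  These n + 1 values
of s exhaust the zero set ([normCay_zeros]), since Cay_(n+1)(x; n) has degree
n + 1 in x. *)

(** * Determinants of tridiagonal matrices *)

Definition tridiag {A : comNzRingType} (a b c : nat -> A) (k : nat) : 'M[A]_k :=
  \matrix_(i < k, j < k)
     (if j == i :> nat then a i
      else if j == i.+1 :> nat then b i
      else if i == j.+1 :> nat then c j
      else 0).

(** In the last row only the last two entries are nonzero; the minor of the
off-diagonal one has a single nonzero entry in its last column, which makes
the product of the two off-diagonal entries appear. *)
Lemma det_tridiagSS {A : comNzRingType} (a b c : nat -> A) (k : nat) :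
  \det (tridiag a b c k.+2) =
  a k.+1 * \det (tridiag a b c k.+1) - b k * c k * \det (tridiag a b c k).
Proof.
rewrite (expand_det_row _ ord_max) big_ord_recr /= big_ord_recr /=.
rewrite big1 ?add0r => [|j _]; last first.
  rewrite !mxE /=; have := ltn_ord j.
  by do 3![case: eqP => [|_]; first lia]; rewrite mul0r.
rewrite !mxE /=; do 2![case: eqP => [|_]; first lia]; rewrite !eqxx.
rewrite addrC; congr (_ * _ + _).
  rewrite /cofactor -signr_odd addnn odd_double mul1r; congr (\det _).
  by apply/matrixP=> i j; rewrite !mxE !lift_max.
rewrite /cofactor /= addSn -signr_odd /= addnn odd_double expr1 mulN1r.
(* The minor at (k + 1, k) keeps rows 0, ..., k and loses column k, so its last
   column is column k + 1 of the matrix, which in these rows is nonzero only at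
   row k. *)
rewrite (expand_det_col _ ord_max) big_ord_recr /=.
rewrite big1 ?add0r => [|i _]; last first.
  rewrite !mxE !lift_max /= /bump leqnn add1n; have := ltn_ord i.
  by do 3![case: eqP => [|_]; first lia]; rewrite mul0r.
rewrite !mxE !lift_max /= /bump leqnn add1n.
case: eqP => [|_]; [lia|rewrite eqxx].
rewrite /cofactor -signr_odd addnn odd_double mul1r mulrN mulrCA -mulrA.
congr (- (_ * (_ * \det _))).
have lift_widen j :
    lift (widen_ord (leqnSn k.+1) ord_max) (lift ord_max j) = j :> nat.
  by rewrite /= /bump (leqNgt k j) ltn_ord add0n leqNgt ltn_ord.
by apply/matrixP=> i j; rewrite ![in LHS]mxE [in RHS]mxE lift_widen !lift_max.
Qed.

(** * Cayley continuants at y = n *)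

Lemma Cay0 (R : realType) : Cay R 0 = 1.
Proof. exact: det_mx00. Qed.

Lemma Cay1 (R : realType) : Cay R 1 = 'X.
Proof. by rewrite /Cay det_mx11 mxE eqxx. Qed.

Lemma CaySS (R : realType) (k : nat) :
  Cay R k.+2 = 'X * Cay R k.+1 - k.+1%:R * ('Y - k%:R) * Cay R k.
Proof.
exact: (det_tridiagSS (fun=> 'X) (fun i => i.+1%:R) (fun j => 'Y - j%:R)).
Qed.

(** Specializing y first yields a polynomial in x over a field, whose roots can
be counted. *)
Definition CayAt (R : realType) (n k : nat) : {poly R[i]} :=
  map_poly (horner_eval n%:R) (Cay R k).

Section CayleyValues.
Variables (R : realType) (n : nat).
Implicit Types (s : R[i]) (k l : nat).

Lemma horner_CayAt k s : (CayAt R n k).[s] = (Cay R k).[s, n%:R].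
Proof.
rewrite /CayAt -[in LHS](hornerC s n%:R) -[_.[n%:R]]/(horner_eval n%:R s%:P).
by rewrite horner_map.
Qed.

Lemma CayAt0 : CayAt R n 0 = 1.
Proof. by rewrite /CayAt Cay0 rmorph1. Qed.

Lemma CayAt1 : CayAt R n 1 = 'X.
Proof. by rewrite /CayAt Cay1 map_polyX. Qed.

Lemma CayAtSS k :
  CayAt R n k.+2 =
  'X * CayAt R n k.+1 - (k.+1%:R * (n%:R - k%:R))%:P * CayAt R n k.
Proof.
rewrite /CayAt CaySS rmorphB !rmorphM rmorphB /= map_polyX !rmorph_nat.
by rewrite map_polyC /= /horner_eval hornerX rmorphB !rmorph_nat.
Qed.

Lemma size_CayAt k : size (CayAt R n k) = k.+1.
Proof.
have [] : size (CayAt R n k) = k.+1 /\ size (CayAt R n k.+1) = k.+2.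
  elim: k => [|k [IH1 IH2]].
    by rewrite CayAt0 CayAt1 size_poly1 size_polyX.
  split=> //; have CayN0 : CayAt R n k.+1 != 0 by rewrite -size_poly_gt0 IH2.
  rewrite CayAtSS size_polyDl ['X * _]mulrC size_mulX ?IH2 //
    size_polyN mul_polyC.
  by rewrite (leq_ltn_trans (size_scale_leq _ _)) // IH1.
by [].
Qed.

(** Dividing by k! turns the recurrence of the continuants into one that is
invariant under k -> n - k, and into that of a generating polynomial. *)
Definition normCay s k : R[i] := (Cay R k).[s, n%:R] / k`!%:R.

Lemma factC_neq0 k : k`!%:R != 0 :> R[i].
Proof. by rewrite pnatr_eq0 -lt0n fact_gt0. Qed.

Lemma normCay0 s : normCay s 0 = 1.
Proof. by rewrite /normCay -horner_CayAt CayAt0 hornerC divr1. Qed.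

Lemma normCay1 s : normCay s 1 = s.
Proof. by rewrite /normCay -horner_CayAt CayAt1 hornerX divr1. Qed.

Lemma normCay_eq0 s k : (normCay s k == 0) = ((Cay R k).[s, n%:R] == 0).
Proof. by rewrite mulf_eq0 invr_eq0 (negbTE (factC_neq0 k)) orbF. Qed.

Lemma normCaySS s k :
  k.+2%:R * normCay s k.+2 =
  s * normCay s k.+1 - (n%:R - k%:R) * normCay s k.
Proof.
rewrite /normCay -!horner_CayAt CayAtSS !hornerE !factS !natrM /=.
by field; rewrite factC_neq0 nat1r -natrD !pnatr_eq0.
Qed.

(** The factor n - k of the recurrence is zero at k = n, so one zero at n + 1
forces a second one, and two consecutive zeros propagate. *)
Lemma normCay_vanish s k : normCay s n.+1 = 0 -> normCay s (n.+1 + k) = 0.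
Proof.
move=> s0.
suff [] : normCay s (n.+1 + k) = 0 /\ normCay s (n.+1 + k).+1 = 0 by [].
elim: k => [|k [IH1 IH2]]; rewrite ?addn0 ?addnS.
  split=> //; have := normCaySS s n.
  rewrite s0 subrr mulr0 mul0r subr0 => /eqP.
  by rewrite mulf_eq0 pnatr_eq0 => /eqP.
split=> //; have := normCaySS s (n.+1 + k).
by rewrite IH1 IH2 !mulr0 subr0 => /eqP; rewrite mulf_eq0 pnatr_eq0 => /eqP.
Qed.

(** Both sides satisfy the same second-order recurrence in k, the left-hand one
because the recurrence of the values is its own reversal.  They agree at k = 0,
and at k = 1 thanks to the vanishing at n + 1. *)
Lemma normCay_reflect s k : normCay s n.+1 = 0 -> (k <= n)%N ->
  normCay s (n - k) = normCay s n * normCay s k.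
Proof.
move=> s0.
suff [] : ((k <= n)%N -> normCay s (n - k) = normCay s n * normCay s k) /\
   ((k < n)%N -> normCay s (n - k.+1) = normCay s n * normCay s k.+1) by [].
elim: k => [|k [IH1 IH2]].
  split=> [_|n_gt0]; first by rewrite subn0 normCay0 mulr1.
  have pred_diff : n%:R - n.-1%:R = 1 :> R[i].
    by rewrite -{1}(prednK n_gt0) -natr1 addrAC subrr add0r.
  have := normCaySS s n.-1.
  rewrite (ltn_predK n_gt0) s0 mulr0 pred_diff mul1r => /esym/subr0_eq e.
  by rewrite subn1 -e normCay1 mulrC.
split=> // kn; have {}IH1 := IH1 (ltnW (ltnW kn)); have {}IH2 := IH2 (ltnW kn).
(* The recurrence at m = n - k - 2 gives the reversed value, the one at k the
   value itself; the coefficients match as n - k = m + 2 and n - m = k + 2. *)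
have [m n_eq] : exists m, n = (m + k.+2)%N.
  by exists (n - k.+2)%N; rewrite subnK.
have ek := normCaySS s k; have em := normCaySS s m.
have nk : (n - k = m.+2)%N by lia.
have nk1 : (n - k.+1 = m.+1)%N by lia.
have -> : (n - k.+2 = m)%N by lia.
have diff_k : n%:R - k%:R = m.+2%:R :> R[i].
  by rewrite -nk natrB // ltnW // ltnW.
have diff_m : n%:R - m%:R = k.+2%:R :> R[i].
  by rewrite n_eq natrD addrAC subrr add0r.
rewrite -nk -nk1 IH1 IH2 diff_m nk in em; rewrite diff_k in ek.
apply: (mulfI (_ : k.+2%:R != 0 :> R[i])); first by rewrite pnatr_eq0.
transitivity (s * (normCay s n * normCay s k.+1) -
  m.+2%:R * (normCay s n * normCay s k)).
  by rewrite em; ring.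
rewrite [RHS]mulrCA ek; ring.
Qed.

End CayleyValues.

(** * The generating polynomial *)

Section GeneratingPolynomial.
Variable F : idomainType.
Implicit Types (a b n : nat).

Definition genPoly a b : {poly F} := (1 + 'X) ^+ a * (1 - 'X) ^+ b.

(** Multiplying by p absorbs the truncated exponent a - 1, so that a = 0 is
covered. *)
Lemma mul_deriv_exp (p : {poly F}) a : p * (p ^+ a)^`() = a%:R * p^`() * p ^+ a.
Proof.
case: a => [|a]; first by rewrite expr0 derivC !mul0r mulr0.
by rewrite deriv_exp /= -mulr_natl exprS; ring.
Qed.

(** The logarithmic derivative is a / (1 + X) - b / (1 - X); here it is cleared
of denominators and expanded for coefficient extraction. *)
Lemma genPoly_ode a b :
  (genPoly a b)^`() - (genPoly a b)^`() * 'X^2 =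
  a%:R * genPoly a b - b%:R * genPoly a b - (a + b)%:R * (genPoly a b * 'X).
Proof.
rewrite /genPoly derivM.
have := mul_deriv_exp (1 + 'X) a; have := mul_deriv_exp (1 - 'X) b.
rewrite !derivD derivN derivC derivX !add0r natrD.
set A' := (_ ^+ a)^`(); set A := _ ^+ a.
set B' := (_ ^+ b)^`(); set B := _ ^+ b.
move=> eB eA.
transitivity ((1 - 'X) * ((1 + 'X) * A') * B + (1 + 'X) * A * ((1 - 'X) * B')).
  by ring.
by rewrite eA eB; ring.
Qed.

Lemma genPoly_coef0 a b : (genPoly a b)`_0 = 1.
Proof. by rewrite -horner_coef0 !hornerE ?oppr0 ?addr0 !expr1n ?mulr1. Qed.

Lemma genPoly_coef1 a b : (genPoly a b)`_1 = a%:R - b%:R.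
Proof.
have /(congr1 (fun p : {poly F} => p`_0)) := genPoly_ode a b.
rewrite !mulr_natl !(coefB, coefMn, coefMXn, coefMX, coef_deriv) /=.
by rewrite genPoly_coef0 mul0rn !subr0.
Qed.

Lemma genPoly_coefSS a b k :
  k.+2%:R * (genPoly a b)`_k.+2 =
  (a%:R - b%:R) * (genPoly a b)`_k.+1 - ((a + b)%:R - k%:R) * (genPoly a b)`_k.
Proof.
have /(congr1 (fun p : {poly F} => p`_k.+1)) := genPoly_ode a b.
rewrite !mulr_natl !(coefB, coefMn, coefMXn, coefMX, coef_deriv) /= subn2 /=.
case: k => [|k] /=.
  by rewrite !subr0 mulrBl !mulr_natl.
rewrite !mulrBl !mulr_natl => /eqP; rewrite subr_eq => /eqP ->.
by rewrite opprB addrA addrAC.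
Qed.

(** Up to the sign (-1)^b this is a product of a + b monic linear factors. *)
Lemma genPoly_lead a b :
  size (genPoly a b) = (a + b).+1 /\ (genPoly a b)`_(a + b) = (-1) ^+ b.
Proof.
have -> : genPoly a b = (-1) ^+ b *: (('X - (-1)%:P) ^+ a * ('X - 1%:P) ^+ b).
  rewrite /genPoly polyCN opprK addrC -(opprB 'X) [in LHS]exprNn.
  by rewrite mulrCA -mul_polyC rmorph_sign.
have mon : ('X - (-1)%:P : {poly F}) ^+ a * ('X - 1%:P) ^+ b \is monic.
  by rewrite rpredM // monic_exp ?monicXsubC.
have size_mon :
    size (('X - (-1)%:P : {poly F}) ^+ a * ('X - 1%:P) ^+ b) = (a + b).+1.
  rewrite size_monicM ?monic_exp ?monicXsubC ?expf_neq0 ?polyXsubC_eq0 //.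
  by rewrite !size_exp_XsubC addnS.
split; first by rewrite size_scale // signr_eq0.
rewrite coefZ -[(a + b)%N]/((a + b).+1.-1) -size_mon.
by rewrite -lead_coefE (monicP mon) mulr1.
Qed.

End GeneratingPolynomial.

(** * The zero set and the sign *)

Section SylvesterValues.
Variables (R : realType) (n : nat).
Implicit Types (s : R[i]) (k l : nat).

(** With a = n - l and b = l one has a - b = s and a + b = n, so both sequences
satisfy the same recurrence with the same initial values. *)
Lemma normCay_genPoly k l : (l <= n)%N ->
  normCay R n (n%:R - 2%:R * l%:R) k = (genPoly R[i] (n - l) l)`_k.
Proof.
move=> ln; set s := _ - _.
have s_eq : s = (n - l)%:R - l%:R by rewrite natrB // /s; ring.
suff [] : normCay R n s k = (genPoly R[i] (n - l) l)`_k /\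
  normCay R n s k.+1 = (genPoly R[i] (n - l) l)`_k.+1 by [].
elim: k => [|k [IH1 IH2]].
  by rewrite normCay0 normCay1 genPoly_coef0 genPoly_coef1.
split=> //; apply: (mulfI (_ : k.+2%:R != 0 :> R[i])).
  by rewrite pnatr_eq0.
by rewrite normCaySS genPoly_coefSS subnK // IH1 IH2 s_eq.
Qed.

(** The n + 1 values n - 2 l are distinct roots of a polynomial of degree n + 1,
because the generating polynomial for l has degree n; a further root s would
be one too many. *)
Lemma normCay_zeros s :
  normCay R n s n.+1 = 0 -> exists2 l, (l <= n)%N & s = n%:R - 2%:R * l%:R.
Proof.
move=> s0; pose node l : R[i] := n%:R - 2%:R * l%:R.
suff /mapP[l] : s \in [seq node l | l <- iota 0 n.+1].
  by rewrite mem_iota => l_le ->; exists l.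
apply/negPn/negP => s_new.
have q_neq0 : CayAt R n n.+1 != 0 by rewrite -size_poly_gt0 size_CayAt.
have rootE t : root (CayAt R n n.+1) t = (normCay R n t n.+1 == 0).
  by rewrite rootE horner_CayAt normCay_eq0.
have all_roots :
    all (root (CayAt R n n.+1)) (s :: [seq node l | l <- iota 0 n.+1]).
  apply/allP => t; rewrite inE => /predU1P[->|/mapP[l l_le ->]].
    by rewrite rootE s0.
  rewrite mem_iota /= in l_le; rewrite rootE normCay_genPoly //.
  have [size_gen _] := genPoly_lead R[i] (n - l) l.
  by rewrite nth_default // size_gen subnK.
have roots_uniq : uniq (s :: [seq node l | l <- iota 0 n.+1]).
  rewrite cons_uniq s_new map_inj_uniq ?iota_uniq // => l1 l2 /addrI/oppr_inj.
  have two_neq0 : 2%:R != 0 :> R[i] by rewrite pnatr_eq0.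
  by move=> /(mulfI two_neq0)/eqP; rewrite eqr_nat => /eqP.
have := max_poly_roots q_neq0 all_roots roots_uniq.
by rewrite size_CayAt /= size_map size_iota ltnn.
Qed.

Lemma normCay_top l : (l <= n)%N ->
  normCay R n (n%:R - 2%:R * l%:R) n = (-1) ^+ l.
Proof.
move=> ln; rewrite normCay_genPoly //.
by have [_] := genPoly_lead R[i] (n - l) l; rewrite subnK.
Qed.

Lemma Cay_palindrome s : zeroset (@Cay R) n.+1 n s ->
  exists2 l, (n%:R - s) / 2%:R = l%:R &
  (forall k, (n.+1 <= k)%N -> (Cay R k).[s, n%:R] = 0) /\
  (forall k, (k <= n)%N -> normCay R n s k = (-1) ^+ l * normCay R n s (n - k)).
Proof.
move=> /eqP; rewrite -normCay_eq0 => /eqP s0.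
have [l ln s_eq] := normCay_zeros _ s0; exists l.
  by rewrite s_eq opprB addrC subrK mulrAC divff ?mul1r // pnatr_eq0.
split=> k kn.
  by apply/eqP; rewrite -normCay_eq0 -(subnKC kn) normCay_vanish.
by rewrite normCay_reflect // s_eq normCay_top // mulrA -expr2 sqrr_sign mul1r.
Qed.

End SylvesterValues.

(* The last conjunct includes that (n - s) / 2 is an integer l, so that the
   exponent in (-1) ^ ((n - s) / 2) makes sense. *)
Theorem theorem8p8 (R : realType) :
  palindromic_pair (@Cay R) (fun k : nat => (k`!)%:R) (fun n : nat => n%:R)
  /\
  forall (n : nat) (s : R[i]), zeroset (@Cay R) n.+1 n s ->
    (forall k : nat, (n.+1 <= k)%N -> (Cay R k).[s, n%:R] = 0)
    /\
    exists l : int,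
      [/\ (n%:R - s) / 2%:R = l%:~R,
          forall k : nat, (k <= n)%N ->
            (Cay R k).[s, n%:R] / (k`!)%:R =
            (-1) ^ l * ((Cay R (n - k)%N).[s, n%:R] / ((n - k)`!)%:R) &
          (Cay R n).[s, n%:R] = (-1) ^ l * (n`!)%:R].
Proof.
have palindrome n := @Cay_palindrome R n; split.
  split=> [|k|n m /eqP]; first exact: Cay0.
    exact: factC_neq0.
  rewrite eqr_nat => /eqP -> {n}.
  (* The top value is c_m = (-1)^l, which gives the sign without choosing l. *)
  exists (fun s => normCay R m s m) => s zs.
  have [l _ [vanish refl]] := palindrome m s zs.
  have sgn : normCay R m s m = (-1) ^+ l.
    by rewrite refl // subnn normCay0 mulr1.
  by rewrite sgn; split => //; rewrite -signr_odd; case: odd; [right|left].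
move=> n s zs; have [l l_eq [vanish refl]] := palindrome n s zs.
split=> //; exists l; split=> //.
(* The last claim is the palindrome identity at k = n, as c_0 = 1. *)
rewrite -[LHS](divfK (factC_neq0 R n)); congr (_ * _).
by rewrite -[LHS]/(normCay R n s n) refl // subnn normCay0 mulr1.
Qed.
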